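(* For each $s\in\{5,6\}$, the problem List $3$-Colouring is solvable in polynomial time when the input graphs are restricted to $C_s$-free graphs of diameter $2$.
   Context: Graphs are finite, simple and undirected. $C_s$ denotes the cycle on $s$ vertices. A graph $G$ is $H$-free if $G$ does not contain $H$ as an induced subgraph. The distance $\mathrm{dist}(u,v)$ between two vertices is the number of edges of a shortest path between them, and the diameter of $G$ is the maximum distance over all pairs of vertices of $G$. A colouring of $G=(V,E)$ is a map $c$ from $V$ to the positive integers with $c(u)\neq c(v)$ for every two adjacent vertices $u,v$. A list $3$-assignment of $G$ is a function $L$ assigning to each $u\in V$ a list $L(u)\subseteq\{1,2,3\}$. A colouring $c$ respects $L$ if $c(u)\in L(u)$ for every $u\in V$. The problem List $3$-Colouring takes as input a graph $G$ with a list $3$-assignment $L$ and asks whether $G$ has a colouring that respects $L$. *)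

(* Defs.v *)
From mathcomp Require Import all_boot all_algebra.

Set Implicit Arguments.
Unset Strict Implicit.
Unset Printing Implicit Defensive.

(** * Graphs *)

Record sgraph (V : finType) := SGraph {
  adj :> rel V;
  adj_sym : symmetric adj;
  adj_irr : irreflexive adj }.

Definition cycle_rel (s : nat) : rel 'I_s :=
  fun i j => (i != j) && ((j == ordS i) || (i == ordS j)).

Lemma cycle_rel_sym s : symmetric (@cycle_rel s).
Proof. by move=> i j; rewrite /cycle_rel eq_sym orbC. Qed.

Lemma cycle_rel_irr s : irreflexive (@cycle_rel s).
Proof. by move=> i; rewrite /cycle_rel eqxx. Qed.

(* This is the cycle on s vertices for s >= 3; the test [i != j] in
   [cycle_rel] only matters for s = 1. *)
Definition cycle_graph (s : nat) : sgraph 'I_s :=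
  SGraph (@cycle_rel_sym s) (@cycle_rel_irr s).

Definition contains_induced (W V : finType) (H : sgraph W) (G : sgraph V) :=
  exists f : W -> V, injective f /\ forall x y, G (f x) (f y) = H x y.

Definition free_of (W V : finType) (H : sgraph W) (G : sgraph V) :=
  ~ contains_induced H G.

Definition joined_by_path (V : finType) (G : sgraph V) (u v : V) (k : nat) :=
  exists p : seq V, [/\ path G u p, uniq (u :: p), last u p = v & size p = k].

(* Distance and diameter are relations: vertices in different components are
   at no finite distance, and a disconnected graph has no diameter. *)
Definition is_dist (V : finType) (G : sgraph V) (u v : V) (k : nat) :=
  joined_by_path G u v k /\ forall j, joined_by_path G u v j -> k <= j.

Definition has_diameter (V : finType) (G : sgraph V) (d : nat) :=
  (forall u v, exists2 k, is_dist G u v k & k <= d)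
  /\ exists u v, is_dist G u v d.

Definition is_colouring (V : finType) (G : sgraph V) (c : V -> nat) :=
  (forall u, 0 < c u) /\ forall u v, G u v -> c u != c v.

Definition respects (V : finType) (c : V -> nat) (L : V -> {pred nat}) :=
  forall u, c u \in L u.

(** * Polynomial time *)

(* The machine model is a unit-cost random-access machine with addition and
   truncated subtraction as its only arithmetic operations, presented with
   structured control flow. The store is a single unbounded array of natural
   numbers and [Get e] is the content of the cell with address [e] (indirect
   addressing). As there is no multiplication, the bit length of the numbers
   grows only linearly with the number of steps, so polynomial time on this
   machine is polynomial time on Turing machines. *)
Inductive expr :=
  | Lit of nat
  | Get of expr
  | Add of expr & expr
  | Sub of expr & expr.

Inductive cmd :=
  | Skip
  | Set_ of expr & expr
  | Seq of cmd & cmd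
  | If of expr & cmd & cmd
  | While of expr & cmd.

Definition store := nat -> nat.

Fixpoint eval (m : store) (e : expr) : nat :=
  match e with
  | Lit k => k
  | Get a => m (eval m a)
  | Add a b => eval m a + eval m b
  | Sub a b => eval m a - eval m b
  end.

Definition update (m : store) (a v : nat) : store :=
  fun i => if i == a then v else m i.

(* [exec c m t m']: run from store m, the command c halts in store m' after
   t steps. Each assignment and each test counts as one step; the size of
   the expressions in a fixed program only contributes a constant factor. *)
Inductive exec : cmd -> store -> nat -> store -> Prop :=
  | ExecSkip m : exec Skip m 1 m
  | ExecSet a e m : exec (Set_ a e) m 1 (update m (eval m a) (eval m e))
  | ExecSeq c1 c2 m m1 m2 t1 t2 :
      exec c1 m t1 m1 -> exec c2 m1 t2 m2 ->
      exec (Seq c1 c2) m (t1 + t2) m2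
  | ExecIfTrue e c1 c2 m m' t :
      eval m e != 0 -> exec c1 m t m' -> exec (If e c1 c2) m t.+1 m'
  | ExecIfFalse e c1 c2 m m' t :
      eval m e = 0 -> exec c2 m t m' -> exec (If e c1 c2) m t.+1 m'
  | ExecWhileTrue e c m m1 m2 t1 t2 :
      eval m e != 0 -> exec c m t1 m1 -> exec (While e c) m1 t2 m2 ->
      exec (While e c) m (t1 + t2).+1 m2
  | ExecWhileFalse e c m :
      eval m e = 0 -> exec (While e c) m 1 m.

(* The length of the input word is in cell 0, its bits are in the cells that
   follow, and all other cells contain 0. *)
Definition init_store (w : seq bool) : store :=
  fun i => if i is j.+1 then nat_of_bool (nth false w j) else size w.

(* [poly_time_solvable enc D Q]: the problem "given x, does Q x hold?", with
   instances x presented as the words [enc x] and restricted to those with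
   [D x], is solvable in polynomial time. The answer is read in cell 0
   (nonzero for yes). *)
Definition poly_time_solvable (I : Type) (enc : I -> seq bool)
    (D Q : I -> Prop) :=
  exists (prog : cmd) (p : {poly nat}), forall x, D x ->
    exists (t : nat) (m : store),
      [/\ exec prog (init_store (enc x)) t m,
          t <= p.[size (enc x)]%R
        & (m 0 != 0) <-> Q x].

(** * List 3-Colouring *)

Record instance := Instance {
  nvert : nat;
  graph : sgraph 'I_nvert;
  lists : 'I_nvert -> {pred nat};
  lists_sub : forall u k, k \in lists u -> k \in [:: 1; 2; 3] }.

Arguments lists : clear implicits.

Definition list_3_colourable (x : instance) :=
  exists c : 'I_(nvert x) -> nat,
    is_colouring (graph x) c /\ respects c (lists x).

(* The number of vertices in unary, then the adjacency matrix row by row,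
   then three membership bits for the list of each vertex. *)
Definition encode (x : instance) : seq bool :=
  nseq (nvert x) true ++ false
    :: [seq graph x u v | u <- enum 'I_(nvert x), v <- enum 'I_(nvert x)]
    ++ [seq k \in lists x u | u <- enum 'I_(nvert x), k <- [:: 1; 2; 3]].

(* Main.v *)
(* Guess three literals (a vertex with its colour), close them under path
   consistency, and accept if every vertex keeps one or two colours. Accepting is
   sound because pairwise intersecting subsets of a two-element set have a
   common element, so that partial solutions extend one vertex at a time.

   Conversely, let c be a colouring and let P contain the guessed vertices and
   every vertex with two differently coloured neighbours in P. A vertex keeping
   all three colours is a vertex v outside P without neighbours in P. By diameter
   two, v has for each s in P a neighbour a_s adjacent to s, and a_s is not
   adjacent to any t in P coloured differently from s.
   If G is C_5-free and s, t in P are adjacent, then v, a_s, s, t, a_t is not an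
   induced cycle, so a_s and a_t are adjacent: hence guessing a triangle leaves a
   K_4 with v, and if there is no triangle then guessing an edge already
   produces one.
   If G is C_6-free and s, t in P are nonadjacent with different colours, then
   their common neighbour r is in P, and v, a_s, s, r, t, a_t shows again that a_s
   and a_t are adjacent. So an independent triple with three colours suffices. If
   there is none, take a triple x, y, z with three colours and x not adjacent to
   y, z: then v has the colour of x (otherwise x and v lie in an independent triple
   with three colours), a_y and a_z have the colours of z and y, and a_x is
   adjacent to both, hence coloured like v, a contradiction. If no such triple exists
   either, then any triple with three colours dominates G. If c uses two colours,
   any edge does. *)

Require Import Defs.
From mathcomp Require Import all_boot all_algebra.
From mathcomp Require Import zify.

Set Implicit Arguments.
Unset Strict Implicit.
Unset Printing Implicit Defensive.

(** * Induced cycles in graphs of diameter two *)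

Section Cycles.
Variables (V : finType) (G : sgraph V).

Lemma induced_c5 (a b c d e : V) : free_of (cycle_graph 5) G ->
  G a b -> G b c -> G c d -> G d e -> G e a ->
  ~~ G a c -> ~~ G b d -> ~~ G c e -> ~~ G d a -> G e b.
Proof.
move=> free ab bc cd de ea ac bd ce da; apply/idPn => eb; apply: free.
pose f (i : 'I_5) := nth a [:: a; b; c; d; e] i.
have fE x y : G (f x) (f y) = cycle_graph 5 x y.
  case: x => [[|[|[|[|[|//]]]]] ?]; case: y => [[|[|[|[|[|//]]]]] ?];
  rewrite /f /= /cycle_rel -!val_eqE /= ?(adj_irr G) //;
  by [|rewrite adj_sym|apply/negbTE|apply/negbTE; rewrite adj_sym].
exists f; split=> // x y fxy.
(* The five vertices are not assumed distinct. Injectivity comes from adjacency: in a cycle other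
   than $C_4$, no second vertex is adjacent to both the successor and the predecessor of [x]. *)
have row z : cycle_graph 5 x z = cycle_graph 5 y z by rewrite -!fE fxy.
have := (row (ordS x), row (ord_pred x)).
move: x y {fxy row} => [[|[|[|[|[|//]]]]] ?] [[|[|[|[|[|//]]]]] ?] [];
by rewrite /= /cycle_rel -!val_eqE //= => *; apply: val_inj.
Qed.

Lemma induced_c6 (a b c d e f : V) : free_of (cycle_graph 6) G ->
  G a b -> G b c -> G c d -> G d e -> G e f -> G f a ->
  ~~ G a c -> ~~ G b d -> ~~ G c e -> ~~ G d f -> ~~ G e a ->
  ~~ G a d -> ~~ G b e -> ~~ G c f -> G f b.
Proof.
move=> free ab bc cd de ef fa ac bd ce df ea ad be cf.
apply/idPn => fb; apply: free.
pose h (i : 'I_6) := nth a [:: a; b; c; d; e; f] i.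
have hE x y : G (h x) (h y) = cycle_graph 6 x y.
  case: x => [[|[|[|[|[|[|//]]]]]] ?]; case: y => [[|[|[|[|[|[|//]]]]]] ?];
  rewrite /h /= /cycle_rel -!val_eqE /= ?(adj_irr G) //;
  by [|rewrite adj_sym|apply/negbTE|apply/negbTE; rewrite adj_sym].
exists h; split=> // x y hxy.
have row z : cycle_graph 6 x z = cycle_graph 6 y z by rewrite -!hE hxy.
have := (row (ordS x), row (ord_pred x)).
move: x y {hxy row} => [[|[|[|[|[|[|//]]]]]] ?] [[|[|[|[|[|[|//]]]]]] ?] [];
by rewrite /= /cycle_rel -!val_eqE //= => *; apply: val_inj.
Qed.

(** * Colour propagation and undominated vertices *)

Variable c : V -> 'I_3.
Hypothesis c_proper : forall u v, G u v -> c u != c v.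
Hypothesis diam2 : forall u v, [\/ u = v, G u v | exists2 w, G u w & G w v].

Definition rainbow (x y z : V) := [&& c x != c y, c x != c z & c y != c z].

(** Two differently coloured neighbours leave a vertex only one colour, so such a set contains all
    vertices whose colour is forced from within it in this way. *)
Definition prop_closed (P : pred V) := forall u w v,
  P u -> P w -> c u != c w -> G u v -> G w v -> P v.

Definition dominates (P : pred V) (v : V) := exists2 u, P u & (u == v) || G u v.

(** [P] ranges over all closed sets, not only the closure of the triple, so that it can later be
    taken to be the set of vertices settled by path consistency. The three vertices may coincide. *)
Definition forcing (x y z : V) := forall P, prop_closed P ->
  P x -> P y -> P z -> forall v, dominates P v.

Lemma third_colour (i j k l : 'I_3) :
  i != j -> i != k -> j != k -> [|| l == i, l == j | l == k].
Proof.
by case: i j k l => [[|[|[|//]]] ?] [[|[|[|//]]] ?] [[|[|[|//]]] ?]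
  [[|[|[|//]]] ?].
Qed.

Lemma no_K4 x y z t :
  G x y -> G x z -> G x t -> G y z -> G y t -> G z t -> False.
Proof.
move=> /c_proper xy /c_proper xz /c_proper xt /c_proper yz /c_proper yt.
move=> /c_proper zt; have := third_colour (c t) xy xz yz.
by rewrite ![c t == _]eq_sym (negbTE xt) (negbTE yt) (negbTE zt).
Qed.

Section Undominated.
Variables (P : pred V) (v : V).
Hypotheses (closedP : prop_closed P) (undom : ~ dominates P v).

Lemma undom_adj u : P u -> ~~ G v u.
Proof.
rewrite adj_sym => Pu; apply/negP=> uv; apply: undom.
by exists u; rewrite ?uv ?orbT.
Qed.

Lemma undom_nbr a : G v a -> ~~ P a.
Proof. by move=> va; apply/negP=> /undom_adj; rewrite va. Qed.

Lemma undom_common u : P u -> exists2 a, G v a & G a u.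
Proof.
move=> Pu; case: (diam2 v u) => [vu|vu|//]; last by have := undom_adj Pu; rewrite vu.
by case: undom; exists u; rewrite ?vu ?eqxx.
Qed.

(** Otherwise closedness puts [a] into [P], and then its neighbour [v] is dominated. *)
Lemma undom_private s t a : P s -> P t -> c s != c t -> G v a -> G a s -> ~~ G a t.
Proof.
move=> Ps Pt st va as_; apply/negP=> at_; have := undom_nbr va.
by rewrite (closedP Ps Pt st) // adj_sym.
Qed.

Lemma c5_join s t a b : free_of (cycle_graph 5) G ->
  P s -> P t -> G s t -> G v a -> G a s -> G v b -> G b t -> G a b.
Proof.
move=> free Ps Pt st va as_ vb bt; have cst := c_proper st.
have ab : ~~ G a t by apply: undom_private va as_.
have bs : ~~ G b s by apply: undom_private vb bt => //; rewrite eq_sym.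
rewrite adj_sym; apply: (induced_c5 (a := v) (b := a) (c := s) (d := t)) => //.
- by rewrite adj_sym.
- by rewrite adj_sym.
- exact: undom_adj.
- by rewrite adj_sym.
- by rewrite adj_sym undom_adj.
Qed.

Lemma c6_join s t a b : free_of (cycle_graph 6) G ->
  P s -> P t -> c s != c t -> ~~ G s t ->
  G v a -> G a s -> G v b -> G b t -> G a b.
Proof.
move=> free Ps Pt cst st va as_ vb bt.
case: (diam2 s t) => [sE|stE|[r sr rt]]; first by rewrite sE eqxx in cst.
  by rewrite stE in st.
have Pr : P r by apply: closedP cst sr _; rewrite // adj_sym.
have at_ : ~~ G a t by apply: undom_private va as_.
have ar : ~~ G a r by apply: undom_private va as_ => //; apply: c_proper.
have bs : ~~ G b s by apply: undom_private vb bt => //; rewrite eq_sym.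
have br : ~~ G b r.
  by apply: undom_private vb bt => //; rewrite eq_sym c_proper.
rewrite adj_sym.
apply: (induced_c6 (a := v) (b := a) (c := s) (d := r) (e := t)) => //.
- by rewrite adj_sym.
- by rewrite adj_sym.
- exact: undom_adj.
- by rewrite adj_sym.
- by rewrite adj_sym undom_adj.
- exact: undom_adj.
- by rewrite adj_sym.
Qed.

End Undominated.

(** Domination is decidable on a finite vertex set; this licenses the arguments by contradiction
    below. *)
Lemma dominates_nn (P : pred V) v : ~ ~ dominates P v -> dominates P v.
Proof.
move=> nn; have [/existsP[u /andP[Pu uv]]|/existsP dom] :=
  boolP [exists u, P u && ((u == v) || G u v)]; first by exists u.
by case: nn => -[u Pu uv]; apply: dom; exists u; rewrite Pu.
Qed.

(** * Existence of forcing triples *)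

Lemma forcing_c5 : free_of (cycle_graph 5) G -> (exists x y, G x y) ->
  exists x y z, forcing x y z.
Proof.
move=> free [x0 [y0 xy0]].
have [/existsP[x /existsP[y /existsP[z /and3P[xy yz xz]]]]|/negP notri] :=
  boolP [exists x, exists y, exists z, [&& G x y, G y z & G x z]].
  exists x, y, z => P clP Px Py Pz v; apply: dominates_nn => und.
  have [a va ax] := undom_common und Px; have [b vb by_] := undom_common und Py.
  have [d vd dz] := undom_common und Pz.
  by apply: (@no_K4 v a b d) => //;
    [apply: (c5_join clP und free Px Py)|apply: (c5_join clP und free Px Pz)
    |apply: (c5_join clP und free Py Pz)].
exists x0, y0, y0 => P clP Px Py _ v; apply: dominates_nn => und.
have [a va ax] := undom_common und Px; have [b vb by_] := undom_common und Py.
apply: notri; apply/existsP; exists v; apply/existsP; exists a; apply/existsP.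
by exists b; rewrite va vb (c5_join clP und free Px Py xy0).
Qed.

(** Only the colours of [x] and [y] occur. If an undominated [v] has the colour of [x], then a
    common neighbour of [v] and [y] can have neither colour; the other case is symmetric. *)
Lemma forcing_edge x y : G x y -> (forall z, ~~ rainbow x y z) -> forcing x y y.
Proof.
move=> xy norb P clP Px Py _ v; apply: dominates_nn => und.
have two z : (c z == c x) || (c z == c y).
  by have := norb z; rewrite /rainbow (c_proper xy) /= negb_and !negbK eq_sym
    [c y == _]eq_sym.
case/orP: (two v) => /eqP cv.
  have [b vb by_] := undom_common und Py.
  by move: (two b) (c_proper vb) (c_proper by_); rewrite cv eq_sym => /orP[]->.
have [a va ax] := undom_common und Px.
by move: (two a) (c_proper va) (c_proper ax); rewrite cv [c y == _]eq_sym => /orP[]->.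
Qed.

Lemma forcing_c6 : free_of (cycle_graph 6) G -> (exists x y, G x y) ->
  exists x y z, forcing x y z.
Proof.
move=> free [x0 [y0 xy0]].
have [/existsP[x /existsP[y /existsP[z /and4P[rb xy xz yz]]]]|/negP noind] :=
  boolP [exists x, exists y, exists z,
    [&& rainbow x y z, ~~ G x y, ~~ G x z & ~~ G y z]].
  exists x, y, z => P clP Px Py Pz v; apply: dominates_nn => und.
  have /and3P[cxy cxz cyz] := rb.
  have [a va ax] := undom_common und Px; have [b vb by_] := undom_common und Py.
  have [d vd dz] := undom_common und Pz.
  by apply: (@no_K4 v a b d) => //;
    [apply: (c6_join clP und free Px Py)|apply: (c6_join clP und free Px Pz)
    |apply: (c6_join clP und free Py Pz)].
have indep x y z : rainbow x y z -> ~~ G x y -> ~~ G x z -> G y z.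
  move=> rb xy xz; apply/idPn => yz; apply: noind.
  by apply/existsP; exists x; apply/existsP; exists y; apply/existsP; exists z;
    rewrite rb xy xz.
have [/existsP[x /existsP[y /existsP[z /and3P[rb xy xz]]]]|/negP noind1] :=
  boolP [exists x, exists y, exists z, [&& rainbow x y z, ~~ G x y & ~~ G x z]].
  exists x, y, z => P clP Px Py Pz v; apply: dominates_nn => und.
  have /and3P[cxy cxz cyz] := rb.
  have [[nvx nvy] nvz] := (undom_adj und Px, undom_adj und Py, undom_adj und Pz).
  have cvx : c v = c x.
    case/or3P: (third_colour (c v) cxy cxz cyz) => /eqP // cv.
    - have := indep v x z; rewrite /rainbow cv eq_sym cxy cyz cxz (negbTE xz).
      by move=> /(_ isT nvx nvz).
    - have := indep v x y; rewrite /rainbow cv eq_sym cxz eq_sym cyz cxy.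
      by rewrite (negbTE xy) => /(_ isT nvx nvy).
  have [a va ax] := undom_common und Px; have [b vb by_] := undom_common und Py.
  have [d vd dz] := undom_common und Pz.
  have ab : G a b by apply: (c6_join clP und free Px Py).
  have ad : G a d by apply: (c6_join clP und free Px Pz).
  move: (c_proper va) (c_proper vb) (c_proper by_) (c_proper vd) (c_proper dz).
  move: (c_proper ab) (c_proper ad).
  case/or3P: (third_colour (c b) cxy cxz cyz) => /eqP->; rewrite ?cvx ?eqxx //.
  case/or3P: (third_colour (c d) cxy cxz cyz) => /eqP->; rewrite ?eqxx //.
  by case/or3P: (third_colour (c a) cxy cxz cyz) => /eqP->; rewrite ?eqxx.
have [/existsP[x /existsP[y /existsP[z rb]]]|/negP norb] :=
  boolP [exists x, exists y, exists z, rainbow x y z].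
  exists x, y, z => P _ Px Py Pz v; apply: dominates_nn => und.
  have [[nvx nvy] nvz] := (undom_adj und Px, undom_adj und Py, undom_adj und Pz).
  have /and3P[cxy cxz cyz] := rb; apply: noind1; apply/existsP; exists v.
  (* [v] replaces the vertex of the triple that has its colour; being adjacent to none of them, it
     forms with the other two a triple excluded by [noind1]. *)
  case/or3P: (third_colour (c v) cxy cxz cyz) => /eqP cv; apply/existsP.
  - by exists y; apply/existsP; exists z; rewrite /rainbow cv cxy cxz cyz nvy.
  - by exists x; apply/existsP; exists z; rewrite /rainbow cv eq_sym cxy cxz cyz nvx.
  - exists x; apply/existsP; exists y.
    by rewrite /rainbow cv eq_sym cxz eq_sym cyz cxy nvx.
exists x0, y0, y0; apply: forcing_edge => // z; apply/negP=> rb; apply: norb.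
by apply/existsP; exists x0; apply/existsP; exists y0; apply/existsP; exists z.
Qed.

End Cycles.

(** * Path consistency *)

Section PathConsistency.
Variables (n : nat) (G : sgraph 'I_n).
Local Notation lit := ('I_n * 'I_3)%type.
Variables (allowed excluded : pred lit).

(** The unary conditions are tested for [p] alone; the symmetry rule in [refute_step] transfers them
    to [q]. *)
Definition clash (p q : lit) :=
  [|| ~~ allowed p, excluded p, G p.1 q.1 && (p.2 == q.2)
    | (p.1 == q.1) && (p.2 != q.2)].

Definition refute_step (X : {set lit * lit}) : {set lit * lit} :=
  [set pq | [|| clash pq.1 pq.2, (pq.2, pq.1) \in X
    | [exists w, [forall a,
        ((pq.1, (w, a)) \in X) || ((pq.2, (w, a)) \in X)]]]].

Definition refuted : {set lit * lit} := fixset refute_step.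

(** The diagonal of the binary relation serves as the unary relation of removed colours. *)
Definition dead (p : lit) := (p, p) \in refuted.

Definition accepting :=
  [forall v, [exists a, dead (v, a)] && [exists a, ~~ dead (v, a)]].

Lemma refute_step_mono : {homo refute_step : X Y / X \subset Y}.
Proof.
move=> X Y /subsetP XY; apply/subsetP=> -[p q]; rewrite !inE /=.
case/or3P=> [->//|/XY->|/existsP[w /forallP h]]; first by rewrite orbT.
apply/or3P/Or33; apply/existsP; exists w; apply/forallP=> a.
by case/orP: (h a) => /XY->; rewrite ?orbT.
Qed.

Lemma refutedE p q : ((p, q) \in refuted) =
  [|| clash p q, (q, p) \in refuted
    | [exists w, [forall a, ((p, (w, a)) \in refuted) || ((q, (w, a)) \in refuted)]]].
Proof. by rewrite /refuted -{1}(fixsetK refute_step_mono) inE. Qed.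

Lemma refuted_iter k : #|{: lit * lit}| <= k -> iter k refute_step set0 = refuted.
Proof.
by move=> ?; rewrite -(subnK (n := k) (m := #|{: lit * lit}|)) // iterD
  (fixsetKn refute_step_mono).
Qed.

Lemma refuted_clash p q : clash p q -> (p, q) \in refuted.
Proof. by rewrite refutedE => ->. Qed.

Lemma refuted_sym p q : ((p, q) \in refuted) = ((q, p) \in refuted).
Proof. by apply/idP/idP => pq; rewrite refutedE pq orbT. Qed.

Lemma refuted_witness w p q :
  (forall a, (p, (w, a)) \in refuted \/ (q, (w, a)) \in refuted) ->
  (p, q) \in refuted.
Proof.
move=> h; rewrite refutedE; apply/or3P/Or33; apply/existsP; exists w.
by apply/forallP=> a; apply/orP.
Qed.

Lemma alive_extend p q w : (p, q) \notin refuted ->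
  exists2 a, (p, (w, a)) \notin refuted & (q, (w, a)) \notin refuted.
Proof.
rewrite refutedE !negb_or => /and3P[_ _ /existsPn/(_ w)/forallPn[a]].
by rewrite negb_or => /andP[? ?]; exists a.
Qed.

(** The witness is the vertex of [p] itself: its own colour is refuted with [p] because [p] is dead,
    and its other colours clash with [p]. *)
Lemma refuted_dead p q : dead p -> (p, q) \in refuted.
Proof.
case: p => v a dp; apply: (refuted_witness (w := v)) => b.
have [->|ab] := eqVneq b a; [by left|left; apply: refuted_clash].
by rewrite /clash /= eqxx eq_sym ab !orbT.
Qed.

Lemma alive_alive p q : (p, q) \notin refuted -> ~~ dead q.
Proof. by apply: contra => /refuted_dead; rewrite refuted_sym. Qed.

Definition settled (f : 'I_n -> 'I_3) : pred 'I_n :=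
  [pred v | [forall a, (a != f v) ==> dead (v, a)]].

Lemma settled_adj f u v : settled f u -> G u v -> dead (v, f u).
Proof.
move=> /forallP su uv; apply: (refuted_witness (w := u)) => a; left.
have [->|au] := eqVneq a (f u); last first.
  by rewrite refuted_sym refuted_dead //; apply: (implyP (su a)).
by apply: refuted_clash; rewrite /clash /= adj_sym uv eqxx !orbT.
Qed.

(** * Completeness: solutions survive path consistency *)

Section Complete.
Variable f : 'I_n -> 'I_3.
Hypotheses (f_proper : forall u v, G u v -> f u != f v).
Hypotheses (f_allowed : forall v, allowed (v, f v)).
Hypothesis f_kept : forall v, ~~ excluded (v, f v).

Lemma solution_alive u v : ((u, f u), (v, f v)) \notin refuted.
Proof.
(* [Y] consists of the pairs not contained in the solution. It is stable under [refute_step], since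
   at every vertex [w] the literal [(w, f w)] prevents a refutation of a pair from the solution. *)
pose Y : {set lit * lit} := [set pq | ~~ ((pq.1.2 == f pq.1.1) && (pq.2.2 == f pq.2.1))].
suff /subsetP sub : refuted \subset Y.
  by apply/negP=> /sub; rewrite inE /= !eqxx.
have stable (X : {set lit * lit}) : X \subset Y -> refute_step X \subset Y.
  move=> /subsetP XY; apply/subsetP=> -[[u' a'] [v' b']]; rewrite !inE /=.
  apply: contraL => /andP[/eqP-> /eqP->]; rewrite !negb_or negbK f_allowed.
  rewrite f_kept /=; apply/and3P; split.
  - apply/andP; split; last by case: eqVneq => // ->; rewrite eqxx.
    by apply/negP=> /andP[/f_proper/negbTE->].
  - by apply/negP=> /XY; rewrite inE /= !eqxx.
  - apply/existsPn=> w; apply/forallPn; exists (f w).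
    by rewrite negb_or; apply/andP; split; apply/negP=> /XY; rewrite inE /= !eqxx.
rewrite /refuted /fixset; elim: #|{: lit * lit}| => [|k IH]; first exact: sub0set.
exact: stable.
Qed.

Lemma settled_closed : prop_closed G f (settled f).
Proof.
move=> u w v su sw uw uv wv; apply/forallP=> a; apply/implyP=> av.
have := settled_adj su uv; have := settled_adj sw wv.
have fu := f_proper uv; have fw := f_proper wv.
by case/or3P: (third_colour a uw fu fw) av => /eqP-> //; rewrite eqxx.
Qed.

(** A settled vertex has lost two colours and removes its remaining one from each neighbour, so
    domination makes every vertex lose a colour. The solution itself keeps one alive everywhere. *)
Lemma accepting_complete :
  (forall v, dominates G (settled f) v) -> accepting.
Proof.
move=> dom; apply/forallP=> v; apply/andP; split; apply/existsP; last first.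
  by exists (f v); apply: solution_alive.
have [u su /orP[/eqP<-|uv]] := dom v; last by exists (f u); apply: settled_adj.
have [a au] : exists a : 'I_3, a != f u.
  by exists (ordS (f u)); case: (f u) => [[|[|[|//]]] ?].
by exists a; have /forallP/(_ a)/implyP := su; apply.
Qed.

Lemma settled_excluded v : (forall a, a != f v -> excluded (v, a)) -> settled f v.
Proof.
move=> ex; apply/forallP=> a; apply/implyP=> /ex xa.
by apply: refuted_clash; rewrite /clash xa orbT.
Qed.

End Complete.

(** * Soundness: acceptance yields a colouring *)

Lemma two_values (S : pred 'I_3) : (exists a, ~~ S a) ->
  exists b d, forall a, S a -> a = b \/ a = d.
Proof.
case=> a Sa; exists (ordS a), (ordS (ordS a)) => e Se.
have ae : e != a by apply: contraNneq Sa => <-.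
by case: a e ae {Sa Se} => [[|[|[|//]]] ?] [[|[|[|//]]] ?] // _;
  (left; exact: val_inj) || (right; exact: val_inj).
Qed.

(* Each vertex has at most two values left, and any two values already chosen
   leave it a common one; pairwise intersecting subsets of a two-element set
   have a common element, so a partial solution always extends. *)
Lemma accepting_extend (s : seq 'I_n) : accepting ->
  exists f : 'I_n -> 'I_3,
    {in s &, forall u v, ((u, f u), (v, f v)) \notin refuted}.
Proof.
move=> /forallP acc; elim: s => [|v s [f fP]]; first by exists (fun=> ord0).
have /andP[dead_v /existsP[a0 a0P]] := acc v.
have [b [d bd]] : exists b d, forall a, ~~ dead (v, a) -> a = b \/ a = d.
  apply: two_values; case/existsP: dead_v => a da.
  by exists a; rewrite negbK.
pose ok a := [forall u, (u \in s) ==> (((u, f u), (v, a)) \notin refuted)].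
have [a /forallP aok av] : exists2 a, ok a & ~~ dead (v, a).
  have common x y : x \in s -> y \in s -> exists2 a, ((x, f x), (v, a)) \notin refuted
      & ((y, f y), (v, a)) \notin refuted.
    by move=> xs ys; apply: alive_extend; apply: fP.
  have [okb|/forallPn[x]] := boolP (ok b).
    (* Compatibility with a chosen literal implies that [b] is alive. With no literal chosen yet,
       [b] may be dead, and the alive colour [a0] is used. *)
    case: (s =P [::]) => [s0|/eqP]; last first.
      rewrite -size_eq0 -lt0n -has_predT => /hasP[x xs _].
      exists b => //; apply: (alive_alive (p := (x, f x))).
      by have /forallP/(_ x) := okb; rewrite xs.
    by exists a0 => //; apply/forallP=> u; rewrite s0.
  rewrite negb_imply negbK => /andP[xs xb].
  have [okd|/forallPn[y]] := boolP (ok d).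
    exists d => //; apply: (alive_alive (p := (x, f x))).
    by have /forallP/(_ x) := okd; rewrite xs.
  rewrite negb_imply negbK => /andP[ys yd].
  (* [x] rules out [b] and [y] rules out [d], yet some value is compatible with both, although only
     [b] and [d] can be alive. *)
  have [a xa ya] := common x y xs ys.
  by case: (bd a (alive_alive xa)) => aE; rewrite aE ?xb ?yd in xa ya.
exists (fun u => if u == v then a else f u) => x y; rewrite !inE.
have [->|xv] := eqVneq x v; have [->|yv] := eqVneq y v => //= xs ys.
- by rewrite refuted_sym; have := aok y; rewrite ys.
- by have := aok x; rewrite xs.
- exact: fP.
Qed.

Lemma accepting_sound : accepting -> exists f : 'I_n -> 'I_3,
  (forall u v, G u v -> f u != f v) /\ forall v, allowed (v, f v).
Proof.
move=> /(accepting_extend (enum 'I_n))[f fP]; exists f.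
have {}fP u v : ~~ clash (u, f u) (v, f v).
  by apply: contra (fP u v (mem_enum _ u) (mem_enum _ v)); apply: refuted_clash.
split=> [u v uv|v].
  by have := fP u v; rewrite /clash /= uv !negb_or /= => /and4P[].
by have := fP v v; rewrite /clash !negb_or negbK => /andP[].
Qed.

End PathConsistency.

(** * A bounded-loop language *)

Inductive bank := Table | Buffer | Answer.

(* Loops and sums always run through [0, L), where L is the length of the input
   word; this makes running times polynomial for syntactic reasons. *)
Inductive term :=
  | TLit of nat
  | TVar of nat
  | TAdd of term & term
  | TSub of term & term
  | TIf of term & term
  | TInput of term
  | TRead of bank & term
  | TSum of nat & term.

Inductive prog :=
  | PSet of bank & term & term
  | PSeq of prog & prog
  | PFor of nat & prog.

Definition upd (f : nat -> nat) (a v : nat) : nat -> nat :=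
  fun i => if i == a then v else f i.

Definition bank_code b := match b with Table => 2 | Buffer => 3 | Answer => 4 end.

Definition memory := bank -> nat -> nat.

Definition set_bank (s : memory) (b : bank) (a v : nat) : memory :=
  fun b' => if bank_code b' == bank_code b then upd (s b') a v else s b'.

Section Semantics.
Variable w : seq bool.
Local Notation L := (size w).

Fixpoint teval (s : memory) (e : nat -> nat) (t : term) : nat :=
  match t with
  | TLit k => k
  | TVar x => e x
  | TAdd t1 t2 => teval s e t1 + teval s e t2
  | TSub t1 t2 => teval s e t1 - teval s e t2
  | TIf t1 t2 => if teval s e t1 != 0 then teval s e t2 else 0
  | TInput t1 => nth false w (teval s e t1)
  | TRead b t1 => s b (teval s e t1)
  | TSum x t1 => \sum_(0 <= i < L) teval s (upd e x i) t1
  end.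

Fixpoint run (e : nat -> nat) (c : prog) (s : memory) : memory :=
  match c with
  | PSet b t1 t2 => set_bank s b (teval s e t1) (teval s e t2)
  | PSeq c1 c2 => run e c2 (run e c1 s)
  | PFor x c1 => iteri L (fun i => run (upd e x i) c1) s
  end.

End Semantics.

(** * Compilation to the random-access machine *)

(* Past the input, memory is divided into five interleaved infinite banks:
   temporaries (0), loop variables (1), and the banks of the source language. *)
Definition cell (j : nat) (a : expr) : expr :=
  Add (Add (Get (Lit 0)) (Lit j.+1)) (Add a (Add a (Add a (Add a a)))).

Definition tmp (d : nat) := cell 0 (Lit d).
Definition var (x : nat) := cell 1 (Lit x).

(* The loop variable is saved in temporary [d] and restored at the end, so that
   nested bindings of the same name do not interfere. *)
Definition loop (d x : nat) (body : cmd) : cmd :=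
  Seq (Set_ (tmp d) (Get (var x)))
  (Seq (Set_ (var x) (Lit 0))
  (Seq (While (Defs.Sub (Get (Lit 0)) (Get (var x)))
          (Seq body (Set_ (var x) (Add (Get (var x)) (Lit 1)))))
       (Set_ (var x) (Get (tmp d))))).

(** The value is delivered in temporary [d], and the temporaries below [d], which hold pending
    operands, are preserved. Input reads are guarded because the cells past the word belong to the
    banks, while the source language reads 0 there. *)
Fixpoint tcompile (d : nat) (t : term) : cmd :=
  match t with
  | TLit k => Set_ (tmp d) (Lit k)
  | TVar x => Set_ (tmp d) (Get (var x))
  | TAdd t1 t2 => Seq (tcompile d t1) (Seq (tcompile d.+1 t2)
      (Set_ (tmp d) (Add (Get (tmp d)) (Get (tmp d.+1)))))
  | TSub t1 t2 => Seq (tcompile d t1) (Seq (tcompile d.+1 t2)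
      (Set_ (tmp d) (Defs.Sub (Get (tmp d)) (Get (tmp d.+1)))))
  | TIf t1 t2 => Seq (tcompile d t1) (If (Get (tmp d)) (tcompile d t2) Skip)
  | TInput t1 => Seq (tcompile d t1)
      (If (Defs.Sub (Get (Lit 0)) (Get (tmp d)))
          (Set_ (tmp d) (Get (Add (Get (tmp d)) (Lit 1))))
          (Set_ (tmp d) (Lit 0)))
  | TRead b t1 => Seq (tcompile d t1)
      (Set_ (tmp d) (Get (cell (bank_code b) (Get (tmp d)))))
  | TSum x t1 => Seq (Set_ (tmp d) (Lit 0))
      (loop d.+1 x (Seq (tcompile d.+2 t1)
        (Set_ (tmp d) (Add (Get (tmp d)) (Get (tmp d.+2))))))
  end.

Fixpoint pcompile (d : nat) (c : prog) : cmd :=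
  match c with
  | PSet b t1 t2 => Seq (tcompile d t1) (Seq (tcompile d.+1 t2)
      (Set_ (cell (bank_code b) (Get (tmp d))) (Get (tmp d.+1))))
  | PSeq c1 c2 => Seq (pcompile d c1) (pcompile d c2)
  | PFor x c1 => loop d x (pcompile d.+1 c1)
  end.

(** [N] stands for the input length. A loop costs 2 extra steps per round (test and increment) and 4
    overall (save, reset, last test, restore); a sum adds one addition per round and one
    initialisation. *)
Fixpoint tcost (t : term) (N : nat) : nat :=
  match t with
  | TLit _ | TVar _ => 1
  | TAdd t1 t2 | TSub t1 t2 => tcost t1 N + tcost t2 N + 1
  | TIf t1 t2 => tcost t1 N + tcost t2 N + 2
  | TInput t1 => tcost t1 N + 2
  | TRead _ t1 => tcost t1 N + 1
  | TSum _ t1 => N * (tcost t1 N + 3) + 5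
  end.

Fixpoint pcost (c : prog) (N : nat) : nat :=
  match c with
  | PSet _ t1 t2 => tcost t1 N + tcost t2 N + 1
  | PSeq c1 c2 => pcost c1 N + pcost c2 N
  | PFor _ c1 => N * (pcost c1 N + 2) + 4
  end.

Lemma tcost_poly t : exists p : {poly nat}, forall N, tcost t N = p.[N]%R.
Proof.
elim: t => [k|x|t1 [p pE] t2 [q qE]|t1 [p pE] t2 [q qE]|t1 [p pE] t2 [q qE]
  |t1 [p pE]|b t1 [p pE]|x t1 [p pE]] /=.
- by exists 1%:P%R => N; rewrite hornerC.
- by exists 1%:P%R => N; rewrite hornerC.
- by exists (p + q + 1%:P)%R => N; rewrite !hornerD hornerC pE qE.
- by exists (p + q + 1%:P)%R => N; rewrite !hornerD hornerC pE qE.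
- by exists (p + q + 2%:P)%R => N; rewrite !hornerD hornerC pE qE.
- by exists (p + 2%:P)%R => N; rewrite hornerD hornerC pE.
- by exists (p + 1%:P)%R => N; rewrite hornerD hornerC pE.
- exists ('X * (p + 3%:P) + 5%:P)%R => N.
  by rewrite hornerD hornerM hornerX hornerD !hornerC pE.
Qed.

Lemma pcost_poly c : exists p : {poly nat}, forall N, pcost c N = p.[N]%R.
Proof.
elim: c => [b t1 t2|c1 [p1 p1E] c2 [p2 p2E]|x c1 [p pE]] /=.
- have [p1 p1E] := tcost_poly t1; have [p2 p2E] := tcost_poly t2.
  by exists (p1 + p2 + 1%:P)%R => N; rewrite !hornerD hornerC p1E p2E.
- by exists (p1 + p2)%R => N; rewrite hornerD p1E p2E.
- exists ('X * (p + 2%:P) + 4%:P)%R => N.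
  by rewrite hornerD hornerM hornerX hornerD !hornerC pE.
Qed.

(** * Correctness and running time of the compiled code *)

Section Correct.
Variable w : seq bool.
Local Notation L := (size w).

(** Cells 0 to [L] hold the length and the bits of the word, so the banks start at [L + 1]. *)
Definition address (j i : nat) := L + j.+1 + 5 * i.

Definition represents (m : store) (t e : nat -> nat) (s : memory) :=
  [/\ m 0 = L, forall i, i < L -> m i.+1 = nth false w i,
      forall i, m (address 0 i) = t i, forall x, m (address 1 x) = e x
    & forall b i, m (address (bank_code b) i) = s b i].

Lemma address_eq j i j' i' : j < 5 -> j' < 5 ->
  (address j i == address j' i') = (j == j') && (i == i').
Proof.
move=> ? ?; apply/eqP/andP => [|[/eqP-> /eqP->] //]; rewrite /address => h.
by have [-> ->] : j = j' /\ i = i' by lia.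
Qed.

Lemma address_neq k j i : k <= L -> (k == address j i) = false.
Proof. by move=> kL; apply/eqP; rewrite /address; lia. Qed.

Lemma bank_code_lt b : bank_code b < 5.
Proof. by case: b. Qed.

Lemma eval_cell m j a : m 0 = L -> eval m (cell j a) = address j (eval m a).
Proof. by rewrite /= /address => ->; lia. Qed.

Section Representation.
Variables (m : store) (t e : nat -> nat) (s : memory).
Hypothesis rep : represents m t e s.

Lemma represents_len : m 0 = L.
Proof. by case: rep. Qed.

Lemma eval_tmp d : eval m (tmp d) = address 0 d.
Proof. by rewrite eval_cell ?represents_len. Qed.

Lemma eval_var x : eval m (var x) = address 1 x.
Proof. by rewrite eval_cell ?represents_len. Qed.

Lemma get_tmp d : eval m (Get (tmp d)) = t d.
Proof. by rewrite -[LHS]/(m (eval m (tmp d))) eval_tmp; case: rep. Qed.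

Lemma get_var x : eval m (Get (var x)) = e x.
Proof. by rewrite -[LHS]/(m (eval m (var x))) eval_var; case: rep. Qed.

Lemma represents_tmp d v : represents (update m (address 0 d) v) (upd t d v) e s.
Proof.
have [m0 mi mt me ms] := rep; split=> [|i iL|i|x|b i]; rewrite /update /upd.
- by rewrite address_neq.
- by rewrite address_neq ?mi.
- by rewrite address_eq //= mt.
- by rewrite address_eq //= me.
- by rewrite address_eq ?bank_code_lt // ms; case: b.
Qed.

Lemma represents_var x v : represents (update m (address 1 x) v) t (upd e x v) s.
Proof.
have [m0 mi mt me ms] := rep; split=> [|i iL|i|y|b i]; rewrite /update /upd.
- by rewrite address_neq.
- by rewrite address_neq ?mi.
- by rewrite address_eq //= mt.
- by rewrite address_eq //= me.
- by rewrite address_eq ?bank_code_lt // ms; case: b.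
Qed.

Lemma represents_bank b a v :
  represents (update m (address (bank_code b) a) v) t e (set_bank s b a v).
Proof.
have [m0 mi mt me ms] := rep; split=> [|i iL|i|y|b' i]; rewrite /update.
- by rewrite address_neq.
- by rewrite address_neq ?mi.
- by rewrite address_eq ?bank_code_lt // mt; case: b.
- by rewrite address_eq ?bank_code_lt // me; case: b.
- by rewrite address_eq ?bank_code_lt // ms /set_bank /upd; case: eqP.
Qed.

Lemma represents_ext e' : e =1 e' -> represents m t e' s.
Proof. by move=> ee; have [? ? ? me ?] := rep; split=> // x; rewrite me. Qed.

End Representation.

(** A total-correctness triple with a time bound. Loop variables and source memory are tracked
    exactly; the temporaries are constrained only through [Q], so scratch cells may end with any
    content. *)
Definition runs (c : cmd) (T : nat) (t e : nat -> nat) (s : memory)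
    (e' : nat -> nat) (s' : memory) (Q : (nat -> nat) -> Prop) :=
  forall m, represents m t e s -> exists k m' t',
    [/\ exec c m k m', k <= T, represents m' t' e' s' & Q t'].

Lemma runs_seq c1 c2 T1 T2 t e s e1 s1 e2 s2 (Q1 Q2 : (nat -> nat) -> Prop) :
  runs c1 T1 t e s e1 s1 Q1 ->
  (forall t1, Q1 t1 -> runs c2 T2 t1 e1 s1 e2 s2 Q2) ->
  runs (Seq c1 c2) (T1 + T2) t e s e2 s2 Q2.
Proof.
move=> h1 h2 m /h1 [k1 [m1 [t1 [x1 l1 r1 q1]]]].
have [k2 [m2 [t2 [x2 l2 r2 q2]]]] := h2 t1 q1 m1 r1.
exists (k1 + k2), m2, t2; split=> //; first exact: ExecSeq x1 x2.
exact: leq_add.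
Qed.

Lemma runs_weaken c T T' t e s e' s' (Q Q' : (nat -> nat) -> Prop) :
  runs c T t e s e' s' Q -> T <= T' -> (forall t', Q t' -> Q' t') ->
  runs c T' t e s e' s' Q'.
Proof.
move=> h TT QQ m /h [k [m' [t' [x l r q]]]]; exists k, m', t'; split=> //.
  exact: leq_trans TT.
exact: QQ.
Qed.

Lemma runs_tmp d a t e s (Q : (nat -> nat) -> Prop) v :
  (forall m, represents m t e s -> eval m a = v) -> Q (upd t d v) ->
  runs (Set_ (tmp d) a) 1 t e s e s Q.
Proof.
move=> av q m r; exists 1, (update m (address 0 d) v), (upd t d v); split=> //.
  by rewrite -(eval_tmp r) -(av m r); apply: ExecSet.
exact: represents_tmp.
Qed.

Lemma runs_var x a t e s e' (Q : (nat -> nat) -> Prop) v :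
  (forall m, represents m t e s -> eval m a = v) -> upd e x v =1 e' -> Q t ->
  runs (Set_ (var x) a) 1 t e s e' s Q.
Proof.
move=> av ee q m r; exists 1, (update m (address 1 x) v), t; split=> //.
  by rewrite -(eval_var r) -(av m r); apply: ExecSet.
exact: (represents_ext (represents_var r x v) ee).
Qed.

Lemma eval_fuel m t e s x : represents m t e s ->
  eval m (Defs.Sub (Get (Lit 0)) (Get (var x))) = L - e x.
Proof.
move=> r; rewrite -[LHS]/(m 0 - eval m (Get (var x))).
by rewrite (get_var r) (represents_len r).
Qed.

(** By induction on the number [j] of remaining rounds; each of them pays for the body, one test and
    one increment. *)
Lemma runs_while x body T (I : nat -> (nat -> nat) -> Prop) e
    (s_ : nat -> memory) :
  (forall i t, i < L -> I i t ->
     runs body T t (upd e x i) (s_ i) (upd e x i) (s_ i.+1) (I i.+1)) ->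
  forall j i t, i + j = L -> I i t ->
  runs (While (Defs.Sub (Get (Lit 0)) (Get (var x)))
          (Seq body (Set_ (var x) (Add (Get (var x)) (Lit 1)))))
    (j * (T + 2) + 1) t (upd e x i) (s_ i) (upd e x L) (s_ L) (I L).
Proof.
move=> step; elim=> [|j IH] i t ijL Iit m r.
  rewrite addn0 in ijL; subst i; exists 1, m, t; split=> //.
  by apply: ExecWhileFalse; rewrite (eval_fuel x r) /upd eqxx subnn.
have iL : i < L by lia.
have /(_ m r)[k1 [m1 [t1 [x1 l1 r1 q1]]]] :
    runs (Seq body (Set_ (var x) (Add (Get (var x)) (Lit 1)))) (T + 1)
      t (upd e x i) (s_ i) (upd e x i.+1) (s_ i.+1) (I i.+1).
  apply: runs_seq (step i t iL Iit) _ => t1 q1.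
  apply: (runs_var (v := i.+1)) q1 => [m1 r1|y].
    rewrite -[LHS]/(eval m1 (Get (var x)) + 1) (get_var r1) /upd eqxx; lia.
  by rewrite /upd; case: eqP.
have [|k2 [m2 [t2 [x2 l2 r2 q2]]]] := IH i.+1 t1 _ q1 m1 r1; first lia.
exists (k1 + k2).+1, m2, t2; split=> //; last by lia.
apply: ExecWhileTrue x1 x2.
by rewrite (eval_fuel x r) /upd eqxx; lia.
Qed.

Lemma runs_loop d x body T (I : nat -> (nat -> nat) -> Prop) e
    (s_ : nat -> memory) t :
  (forall i t, i < L -> I i t ->
     runs body T t (upd e x i) (s_ i) (upd e x i) (s_ i.+1)
       (fun t' => I i.+1 t' /\ t' d = t d)) ->
  I 0 (upd t d (e x)) ->
  runs (loop d x body) (L * (T + 2) + 4) t e (s_ 0) e (s_ L) (I L).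
Proof.
(* The invariant also records the saved value of the loop variable in temporary [d], needed for the
   final restore. *)
move=> step I0; pose J i t' := I i t' /\ t' d = e x.
have -> : L * (T + 2) + 4 = 1 + (1 + (L * (T + 2) + 1 + 1)) by lia.
apply: (runs_seq (e1 := e) (s1 := s_ 0) (Q1 := J 0)).
  apply: (runs_tmp (v := e x)); first by move=> m r; apply: get_var r x.
  by split=> //; rewrite /upd eqxx.
move=> t1 J1; apply: (runs_seq (e1 := upd e x 0) (s1 := s_ 0) (Q1 := J 0)).
  exact: (runs_var (v := 0)).
move=> t2 J2; apply: (runs_seq (e1 := upd e x L) (s1 := s_ L) (Q1 := J L)).
  apply: (runs_while (I := J)) => // i t3 iL [I3 t3d].
  by apply: runs_weaken (step i t3 iL I3) _ _ => // t' [? td]; split; rewrite ?td.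
move=> t3 [I3 t3d]; apply: (runs_var (v := e x)) => // [m r|y].
  by rewrite (get_tmp r).
by rewrite /upd; case: eqP => // ->.
Qed.

Lemma tcompile_runs u : forall d t e s,
  runs (tcompile d u) (tcost u L) t e s e s
    (fun t' => t' d = teval w s e u /\ forall i, i < d -> t' i = t i).
Proof.
have set_d d t v : upd t d v d = v /\ forall i, i < d -> upd t d v i = t i.
  by rewrite /upd eqxx; split=> // i id; rewrite ltn_eqF.
have bin u1 u2 op (o : nat -> nat -> nat) :
    (forall m a b, eval m (op a b) = o (eval m a) (eval m b)) ->
    (forall d t e s, runs (tcompile d u1) (tcost u1 L) t e s e s
      (fun t' => t' d = teval w s e u1 /\ forall i, i < d -> t' i = t i)) ->
    (forall d t e s, runs (tcompile d u2) (tcost u2 L) t e s e s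
      (fun t' => t' d = teval w s e u2 /\ forall i, i < d -> t' i = t i)) ->
    forall d t e s,
    runs (Seq (tcompile d u1) (Seq (tcompile d.+1 u2)
            (Set_ (tmp d) (op (Get (tmp d)) (Get (tmp d.+1))))))
      (tcost u1 L + tcost u2 L + 1) t e s e s
      (fun t' => t' d = o (teval w s e u1) (teval w s e u2) /\
                 forall i, i < d -> t' i = t i).
  move=> opE IH1 IH2 d t e s; rewrite -addnA.
  apply: runs_seq (IH1 d t e s) _ => t1 [v1 p1].
  apply: runs_seq (IH2 d.+1 t1 e s) _ => t2 [v2 p2].
  apply: (runs_tmp (v := o (teval w s e u1) (teval w s e u2))) => [m r|].
    by rewrite opE !(get_tmp r) v2 p2 // v1.
  have [-> p3] := set_d d t2 (o (teval w s e u1) (teval w s e u2)).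
  by split=> // i id; rewrite p3 // p2 ?p1 // ltnW.
elim: u => [k|x|u1 IH1 u2 IH2|u1 IH1 u2 IH2|u1 IH1 u2 IH2|u1 IH1|b u1 IH1|x u1 IH1]
  d t e s /=.
- exact: (runs_tmp (v := k)).
- by apply: (runs_tmp (v := e x)) => // m r; apply: get_var r x.
- exact: (bin u1 u2 Add addn).
- exact: (bin u1 u2 Defs.Sub subn).
- rewrite -addnA; apply: runs_seq (IH1 d t e s) _ => t1 [v1 p1] m r.
  have [v0|v0] := eqVneq (teval w s e u1) 0.
    exists 2, m, t1; split=> //; last by rewrite v1 v0.
      by apply: ExecIfFalse (ExecSkip m); rewrite (get_tmp r) v1.
    by lia.
  have [k [m' [t' [x' l' r' [v' p']]]]] := IH2 d t1 e s m r.
  exists k.+1, m', t'; split=> //; first 1 last.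
  + by lia.
  + by split=> // i id; rewrite p' ?p1.
  + by apply: ExecIfTrue x'; rewrite (get_tmp r) v1.
- apply: runs_seq (IH1 d t e s) _ => t1 [v1 p1] m r.
  have test : eval m (Defs.Sub (Get (Lit 0)) (Get (tmp d))) = L - teval w s e u1.
    rewrite -[LHS]/(m 0 - eval m (Get (tmp d))) (get_tmp r) v1.
    by rewrite (represents_len r).
  have [inw|outw] := ltnP (teval w s e u1) L.
    exists 2, (update m (address 0 d) (nth false w (teval w s e u1))),
      (upd t1 d (nth false w (teval w s e u1))); split=> //.
    + apply: ExecIfTrue; first by rewrite test; lia.
      rewrite -(eval_tmp r).
      suff <- : eval m (Get (Add (Get (tmp d)) (Lit 1))) =
          nth false w (teval w s e u1) by apply: ExecSet.
      rewrite -[LHS]/(m (eval m (Get (tmp d)) + 1)) (get_tmp r) v1 addn1.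
      by case: r => _ -> .
    + exact: represents_tmp.
    + by have [-> p2] := set_d d t1 (nth false w (teval w s e u1)); split=> // i id;
        rewrite p2 ?p1.
  exists 2, (update m (address 0 d) 0), (upd t1 d 0); split=> //.
  + apply: ExecIfFalse; first by rewrite test; lia.
    by rewrite -(eval_tmp r); apply: ExecSet.
  + exact: represents_tmp.
  + have [-> p2] := set_d d t1 0; rewrite nth_default //; split=> // i id.
    by rewrite p2 ?p1.
- apply: runs_seq (IH1 d t e s) _ => t1 [v1 p1].
  apply: (runs_tmp (v := s b (teval w s e u1))) => [m r|].
    rewrite -[LHS]/(m (eval m (cell (bank_code b) (Get (tmp d))))).
    rewrite eval_cell ?(represents_len r) // (get_tmp r) v1.
    by case: r => _ _ _ _ ->.
  by have [-> p2] := set_d d t1 (s b (teval w s e u1)); split=> // i id; rewrite p2 ?p1.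
have -> : L * (tcost u1 L + 3) + 5 = 1 + (L * (tcost u1 L + 1 + 2) + 4) by lia.
apply: (runs_seq (e1 := e) (s1 := s) (Q1 := eq (upd t d 0))).
  exact: (runs_tmp (v := 0)).
move=> _ <-.
(* Temporary [d] accumulates the sum, [d.+1] keeps the saved loop variable, and [d.+2] receives the
   summand. *)
pose I i t' := t' d = \sum_(0 <= j < i) teval w s (upd e x j) u1 /\
  forall j, j < d -> t' j = t j.
apply: (runs_loop (I := I) (s_ := fun=> s)); last first.
  split; first by rewrite /upd eqxx ltn_eqF // big_geq.
  by move=> j jd; rewrite /upd !ltn_eqF // ltnW.
move=> i t1 iL [acc p1].
apply: runs_seq (IH1 d.+2 t1 (upd e x i) s) _ => t2 [v2 p2].
apply: (runs_tmp (v := t1 d + teval w s (upd e x i) u1)) => [m r|].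
  rewrite -[LHS]/(eval m (Get (tmp d)) + eval m (Get (tmp d.+2))).
  by rewrite !(get_tmp r) v2 p2.
split; last by rewrite /upd gtn_eqF // p2.
split=> [|j jd]; first by rewrite /upd eqxx big_nat_recr //= acc.
by rewrite /upd ltn_eqF // p2 ?p1 // ltnW // ltnW.
Qed.

Lemma pcompile_runs c : forall d t e s,
  runs (pcompile d c) (pcost c L) t e s e (run w e c s)
    (fun t' => forall i, i < d -> t' i = t i).
Proof.
elim: c => [b u1 u2|c1 IH1 c2 IH2|x c1 IH1] d t e s /=.
- rewrite -addnA; apply: runs_seq (@tcompile_runs u1 d t e s) _ => t1 [v1 p1].
  apply: runs_seq (@tcompile_runs u2 d.+1 t1 e s) _ => t2 [v2 p2] m r.
  exists 1, (update m (address (bank_code b) (teval w s e u1)) (teval w s e u2)), t2.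
  split=> //; last by move=> i id; rewrite p2 ?p1 // ltnW.
    rewrite -v2 -{1}v1 -(p2 d) // -2!(get_tmp r) -eval_cell ?(represents_len r) //.
    exact: ExecSet.
  exact: represents_bank.
- apply: runs_seq (IH1 d t e s) _ => t1 p1.
  by apply: runs_weaken (IH2 d t1 e _) _ _ => // t2 p2 i id; rewrite p2 ?p1.
- apply: (runs_loop (I := fun _ t' => forall i, i < d -> t' i = t i)
    (s_ := fun i => iteri i (fun i => run w (upd e x i) c1) s)); last first.
    by move=> i id; rewrite /upd ltn_eqF.
  move=> i t1 iL p1; apply: runs_weaken (IH1 d.+1 t1 (upd e x i) _) _ _ => // t2 p2.
  split=> [j jd|]; last by rewrite p2.
  by rewrite p2 ?p1 // ltnW.
Qed.

End Correct.

Definition solver (c : prog) : cmd :=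
  Seq (pcompile 0 c) (Set_ (Lit 0) (Get (cell (bank_code Answer) (Lit 0)))).

Lemma solver_exec c w : exists k m,
  [/\ exec (solver c) (init_store w) k m, k <= pcost c (size w) + 1
    & m 0 = run w (fun=> 0) c (fun _ _ => 0) Answer 0].
Proof.
have r0 : represents w (init_store w) (fun=> 0) (fun=> 0) (fun _ _ => 0).
  have out j i : init_store w (address w j i) = 0.
    by rewrite /init_store /address addnS addSn nth_default //; lia.
  by split=> // *; rewrite out.
have [k [m [t [x l r _]]]] := pcompile_runs (w := w) c 0 r0.
exists (k + 1), (update m 0 (run w (fun=> 0) c (fun _ _ => 0) Answer 0)).
split; [|by lia|by rewrite /update eqxx].
apply: ExecSeq x _.
suff <- : eval m (Get (cell (bank_code Answer) (Lit 0))) =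
    run w (fun=> 0) c (fun _ _ => 0) Answer 0 by apply: ExecSet.
rewrite -[LHS]/(m (eval m (cell (bank_code Answer) (Lit 0)))).
rewrite (eval_cell (w := w)) ?(represents_len r) //.
by case: r => _ _ _ _ <-.
Qed.

Lemma poly_time_prog (I : Type) (enc : I -> seq bool) (D Q : I -> Prop) (c : prog) :
  (forall x, D x ->
    run (enc x) (fun=> 0) c (fun _ _ => 0) Answer 0 != 0 <-> Q x) ->
  poly_time_solvable enc D Q.
Proof.
move=> correct; have [p pE] := pcost_poly c.
exists (solver c), (p + 1%:P)%R => x Dx.
have [k [m [ex le m0]]] := solver_exec c (enc x); exists k, m; split=> //.
  by rewrite hornerD hornerC -pE.
by rewrite m0; apply: correct.
Qed.

(** * The algorithm *)

(* Variables 0 and 1 hold the two literals under consideration, 2 a vertex, 5, 6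
   and 7 the guessed literals, 3 and 4 count rounds; from 10 on they are bound
   inside the terms below, whose arguments must not mention them. *)
Definition tnot t := TSub (TLit 1) t.
Definition teq t1 t2 := tnot (TAdd (TSub t1 t2) (TSub t2 t1)).
Definition tlt t1 t2 := TSub t2 t1.

(* The vertices are counted by the positions x such that no bit up to x is 0. *)
Definition t_stopped :=
  TSum 11 (TIf (tnot (tlt (TVar 10) (TVar 11))) (tnot (TInput (TVar 11)))).

Definition t_nvert := TSum 10 (tnot t_stopped).

(* The literal "vertex u has colour a + 1" is numbered 3 * u + a. *)
Definition t_lit (x a : nat) :=
  TAdd (TAdd (TVar x) (TAdd (TVar x) (TVar x))) (TLit a).

(** Division by 3 as a count: the quotient is the number of [i] with [3 * i + 3] at most the
    dividend. *)
Definition t_vertex (x : nat) := TSum 12 (tnot (tlt (TVar x) (t_lit 12 3))).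

Definition t_colour (x : nat) :=
  TSub (TVar x) (TAdd (t_vertex x) (TAdd (t_vertex x) (t_vertex x))).

(** Multiplication by the number of vertices, as a repeated sum; it is exact for values of [t] up to
    [L]. *)
Definition t_row (t : term) := TSum 13 (TIf (tlt (TVar 13) t) t_nvert).

Definition t_adj (x y : nat) :=
  TInput (TAdd (TAdd (TAdd t_nvert (TLit 1)) (t_row (t_vertex x))) (t_vertex y)).

Definition t_allowed (x : nat) :=
  TInput (TAdd (TAdd (TAdd t_nvert (TLit 1)) (t_row t_nvert)) (TVar x)).

(** Summing a constant over all positions multiplies it by [L], so this is a position in an [L] by
    [L] table. *)
Definition t_index (t1 t2 : term) := TAdd t1 (TSum 14 t2).

Definition t_refuted (t1 t2 : term) := TRead Table (t_index t1 t2).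

Definition t_excluded1 (x g : nat) :=
  TIf (teq (t_vertex x) (t_vertex g)) (tnot (teq (TVar x) (TVar g))).

Definition t_excluded (x : nat) :=
  TAdd (t_excluded1 x 5) (TAdd (t_excluded1 x 6) (t_excluded1 x 7)).

Definition t_clash :=
  TAdd (tnot (t_allowed 0)) (TAdd (t_excluded 0)
    (TAdd (TIf (t_adj 0 1) (teq (t_colour 0) (t_colour 1)))
          (TIf (teq (t_vertex 0) (t_vertex 1))
               (tnot (teq (t_colour 0) (t_colour 1)))))).

Definition t_blocks (a : nat) :=
  TAdd (t_refuted (TVar 0) (t_lit 2 a)) (t_refuted (TVar 1) (t_lit 2 a)).

Definition t_step :=
  TAdd t_clash (TAdd (t_refuted (TVar 1) (TVar 0))
    (TSum 2 (TIf (tlt (TVar 2) t_nvert)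
                 (TIf (t_blocks 0) (TIf (t_blocks 1) (t_blocks 2)))))).

Definition t_dead (a : nat) := t_refuted (t_lit 2 a) (t_lit 2 a).

Definition t_accept :=
  tnot (TSum 2 (TIf (tlt (TVar 2) t_nvert) (tnot
    (TIf (TAdd (t_dead 0) (TAdd (t_dead 1) (t_dead 2)))
         (tnot (TIf (t_dead 0) (TIf (t_dead 1) (t_dead 2)))))))).

Definition p_write (b : bank) (t : term) :=
  PFor 0 (PFor 1 (PSet b (t_index (TVar 0) (TVar 1)) t)).

(* The detour through [Buffer] lets [t] refer to the old contents of [Table]. *)
Definition p_update (t : term) :=
  PSeq (p_write Buffer t) (p_write Table (TRead Buffer (t_index (TVar 0) (TVar 1)))).

(** The table is cleared of the previous guess first. The two nested loops give [L * L] rounds, at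
    least the number of pairs of literals, so the fixed point is reached. *)
Definition p_guess :=
  PSeq (p_update (TLit 0)) (PSeq (PFor 3 (PFor 4 (p_update t_step)))
    (PSet Answer (TLit 0) (TAdd (TRead Answer (TLit 0)) t_accept))).

Definition p_main := PFor 5 (PFor 6 (PFor 7 p_guess)).

Lemma iteri_inv (T : Type) (I : nat -> T -> Prop) (f : nat -> T -> T) k s :
  I 0 s -> (forall i s', i < k -> I i s' -> I i.+1 (f i s')) -> I k (iteri k f s).
Proof.
move=> I0 step; suff : forall i, i <= k -> I i (iteri i f s) by apply.
by elim=> [//|i IH] ik; apply: step (IH (ltnW ik)).
Qed.

Fixpoint reads (b : bank) (t : term) : bool :=
  match t with
  | TLit _ | TVar _ => false
  | TAdd t1 t2 | TSub t1 t2 | TIf t1 t2 => reads b t1 || reads b t2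
  | TInput t1 | TSum _ t1 => reads b t1
  | TRead b' t1 => (bank_code b' == bank_code b) || reads b t1
  end.

Lemma teval_frame w b t s s' e : ~~ reads b t ->
  (forall b', bank_code b' != bank_code b -> s' b' =1 s b') ->
  teval w s' e t = teval w s e t.
Proof.
move=> rt ss; elim: t rt e => [k|x|u1 IH1 u2 IH2|u1 IH1 u2 IH2|u1 IH1 u2 IH2
  |u1 IH1|b' u1 IH1|x u1 IH1] //=.
- by rewrite negb_or => /andP[r1 r2] e; rewrite IH1 ?IH2.
- by rewrite negb_or => /andP[r1 r2] e; rewrite IH1 ?IH2.
- by rewrite negb_or => /andP[r1 r2] e; rewrite IH1 ?IH2.
- by move=> r1 e; rewrite IH1.
- by rewrite negb_or => /andP[r0 r1] e; rewrite IH1 ?ss.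
- by move=> r1 e; apply: eq_bigr => i _; rewrite IH1.
Qed.

Lemma run_for w e x c s :
  run w e (PFor x c) s = iteri (size w) (fun i => run w (upd e x i) c) s.
Proof. by []. Qed.

(** * Evaluation of terms and table updates *)

Section Evaluation.
Variable w : seq bool.
Local Notation L := (size w).

Lemma index_inj p q p' q' : p < L -> p' < L ->
  (p + L * q == p' + L * q') = (p == p') && (q == q').
Proof.
move=> pL pL'; apply/eqP/andP => [h|[/eqP-> /eqP->]//].
have L0 : 0 < L by apply: leq_ltn_trans pL.
have pE : p = p'.
  have := congr1 (modn^~ L) h.
  by rewrite ![L * _]mulnC ![_ + _ * L]addnC !modnMDl !modn_small.
by move/eqP: h; rewrite pE eqn_add2l eqn_pmul2l // eqxx.
Qed.

Lemma run_write b t e s : ~~ reads b t ->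
  let s' := run w e (p_write b t) s in
  (forall p q, p < L -> q < L ->
     s' b (p + L * q) = teval w s (upd (upd e 0 p) 1 q) t) /\
  (forall b', bank_code b' != bank_code b -> s' b' =1 s b').
Proof.
move=> rt; pose e' p q := upd (upd e 0 p) 1 q.
(* The entries lexicographically before [(i, j)] are already written; a complete row turns [J i L]
   into [J i.+1 0]. *)
pose J i j (s' : memory) :=
  (forall p q, p < L -> q < L -> (p < i) || (p == i) && (q < j) ->
     s' b (p + L * q) = teval w s (e' p q) t) /\
  (forall b', bank_code b' != bank_code b -> s' b' =1 s b').
have inner i s' : i < L -> J i 0 s' ->
    J i.+1 0 (run w (upd e 0 i) (PFor 1 (PSet b (t_index (TVar 0) (TVar 1)) t)) s').
  move=> iL Ji; suff [h1 h2] :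
      J i L (run w (upd e 0 i) (PFor 1 (PSet b (t_index (TVar 0) (TVar 1)) t)) s').
    split=> // p q pL qL; rewrite ltn0 andbF orbF ltnS => pi; apply: h1 => //.
    by rewrite qL andbT orbC -leq_eqVlt.
  apply: iteri_inv Ji _ => j s1 jL [h1 h2].
  have idx : teval w s1 (e' i j) (t_index (TVar 0) (TVar 1)) = i + L * j.
    by rewrite /= sum_nat_const_nat subn0.
  rewrite -[X in J _ _ X]/(set_bank s1 b
    (teval w s1 (e' i j) (t_index (TVar 0) (TVar 1))) (teval w s1 (e' i j) t)) idx.
  split=> [p q pL qL pq|b' bb']; last first.
    by move=> k; rewrite /set_bank (negbTE bb') h2.
  rewrite /set_bank eqxx /upd index_inj //.
  have [/andP[/eqP-> /eqP->]|npq] := boolP (_ && _); first exact: (teval_frame _ _ rt h2).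
  apply: h1 => //; move: pq npq; case: (p =P i) => //= _.
  by rewrite ltnS [q <= j]leq_eqVlt; case: (q =P j).
suff [h1 h2] : J L 0 (run w e (p_write b t) s).
  by split=> // p q pL qL; rewrite h1 ?pL.
apply: (iteri_inv (I := fun i => J i 0)); first by split=> // p q _ _; rewrite ltn0 andbF.
exact: inner.
Qed.

Lemma run_update t e s : ~~ reads Buffer t ->
  let s' := run w e (p_update t) s in
  (forall p q, p < L -> q < L ->
     s' Table (p + L * q) = teval w s (upd (upd e 0 p) 1 q) t) /\
  s' Answer =1 s Answer.
Proof.
move=> rt; have [h1 h2] := run_write e s rt.
set s1 := run w e (p_write Buffer t) s in h1 h2.
have [|h3 h4] := @run_write Table (TRead Buffer (t_index (TVar 0) (TVar 1))) e s1.
  by [].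
rewrite -[run w e (p_update t) s]/(run w e (p_write Table _) s1).
split=> [p q pL qL|k]; last by rewrite h4 ?h2.
by rewrite h3 // -h1 //= sum_nat_const_nat subn0.
Qed.

Definition truth (s : memory) (e : nat -> nat) (t : term) : bool := teval w s e t != 0.

Section Truth.
Variables (s : memory) (e : nat -> nat).

Lemma truth_not t : truth s e (tnot t) = ~~ truth s e t.
Proof. by rewrite /truth /=; case: teval => [|k]; rewrite ?subSS ?sub0n. Qed.

Lemma truth_or t1 t2 : truth s e (TAdd t1 t2) = truth s e t1 || truth s e t2.
Proof. by rewrite /truth /= addn_eq0 negb_and. Qed.

Lemma truth_and t1 t2 : truth s e (TIf t1 t2) = truth s e t1 && truth s e t2.
Proof. by rewrite /truth /=; case: (teval w s e t1 != 0). Qed.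

Lemma truth_eq t1 t2 : truth s e (teq t1 t2) = (teval w s e t1 == teval w s e t2).
Proof. by rewrite truth_not truth_or /truth /= -negb_and negbK !subn_eq0 -eqn_leq. Qed.

Lemma truth_lt t1 t2 : truth s e (tlt t1 t2) = (teval w s e t1 < teval w s e t2).
Proof. by rewrite /truth /= subn_eq0 -ltnNge. Qed.

Lemma truth_sum x t : reflect (exists2 i, i < L & truth s (upd e x i) t)
  (truth s e (TSum x t)).
Proof.
rewrite /truth /= big_mkord sum_nat_eq0.
apply: (iffP idP) => [/forallPn[i /= ti]|[i iL ti]]; first by exists i.
by apply/forallPn; exists (Ordinal iL).
Qed.

Lemma truth_input t : truth s e (TInput t) = nth false w (teval w s e t).
Proof. by rewrite /truth /=; case: nth. Qed.

Lemma truth_refuted t1 t2 k1 k2 :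
  teval w s e t1 = k1 -> (forall i, teval w s (upd e 14 i) t2 = k2) ->
  truth s e (t_refuted t1 t2) = (s Table (k1 + L * k2) != 0).
Proof.
move=> h1 h2; rewrite /truth /= h1; under eq_bigr do rewrite h2.
by rewrite sum_nat_const_nat subn0.
Qed.

End Truth.

Lemma sum_ltn k N : \sum_(0 <= i < N) (i < k) = minn N k.
Proof.
elim: N => [|N IH]; first by rewrite big_geq // min0n.
by rewrite big_nat_recr //= IH; lia.
Qed.

Lemma teval_vertex s e x : x != 12 -> e x %/ 3 <= L ->
  teval w s e (t_vertex x) = e x %/ 3.
Proof.
move=> x12 xL; rewrite -[RHS](minn_idPr xL) -sum_ltn.
apply: eq_bigr => i _; rewrite /= /upd (negbTE x12) eqxx; lia.
Qed.

End Evaluation.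

Lemma nth_allpairs (S T R : Type) (f : S -> T -> R) s t x0 y0 z0 i j :
  i < size s -> j < size t ->
  nth z0 [seq f u v | u <- s, v <- t] (i * size t + j) = f (nth x0 s i) (nth y0 t j).
Proof.
elim: s i => [//|u s IH] [|i] /= is_ jt; rewrite nth_cat size_map.
  by rewrite jt (nth_map y0).
rewrite mulSn -addnA ltnNge leq_addr /= addKn; exact: IH.
Qed.

(** * Reading the encoded instance *)

Section Decision.
Variable x : instance.
Local Notation n := (nvert x).
Local Notation w := (encode x).
Local Notation L := (size w).
Local Notation lit := ('I_n * 'I_3)%type.

Definition adjacency_bits : seq bool :=
  [seq graph x u v | u <- enum 'I_n, v <- enum 'I_n].

Definition list_bits : seq bool :=
  [seq k \in lists x u | u <- enum 'I_n, k <- [:: 1; 2; 3]].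

Lemma encodeE : w = nseq n true ++ [:: false] ++ adjacency_bits ++ list_bits.
Proof. by []. Qed.

Lemma size_adjacency_bits : size adjacency_bits = n * n.
Proof. by rewrite size_allpairs size_enum_ord. Qed.

Lemma size_list_bits : size list_bits = n * 3.
Proof. by rewrite size_allpairs size_enum_ord. Qed.

Lemma size_encode : L = n + 1 + n * n + n * 3.
Proof.
by rewrite encodeE !size_cat size_adjacency_bits size_list_bits size_nseq !addnA.
Qed.

Lemma nth_encode_unary i : i < n -> nth false w i.
Proof. by move=> ni; rewrite nth_cat size_nseq ni nth_nseq ni. Qed.

Lemma nth_encode_stop : nth false w n = false.
Proof. by rewrite nth_cat size_nseq ltnn subnn. Qed.

Lemma nth_encode_adj (u v : 'I_n) : nth false w (n + 1 + u * n + v) = graph x u v.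
Proof.
rewrite encodeE nth_cat size_nseq ltnNge -!addnA leq_addr /= addKn add1n /=.
have uvn : u * n + v < n * n.
  have := leq_mul (ltn_ord u) (leqnn n); have := ltn_ord v; rewrite mulSn; lia.
rewrite nth_cat size_adjacency_bits uvn.
have := @nth_allpairs _ _ _ (fun u v => graph x u v) (enum 'I_n) (enum 'I_n)
  u v false u v.
by rewrite !size_enum_ord !nth_ord_enum; apply.
Qed.

Definition allowed (p : lit) := p.2.+1 \in lists x p.1.

Definition code (p : lit) := 3 * p.1 + p.2.

Lemma nth_encode_list (p : lit) : nth false w (n + 1 + n * n + code p) = allowed p.
Proof.
rewrite encodeE nth_cat size_nseq ltnNge -!addnA leq_addr /= addKn add1n /=.
rewrite nth_cat size_adjacency_bits ltnNge leq_addr /= addKn.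
case: p => u a; rewrite /code /= mulnC.
rewrite (nth_allpairs (t := [:: 1; 2; 3]) _ u 0) ?size_enum_ord // nth_ord_enum.
by rewrite /allowed /=; case: a => [[|[|[|//]]] ?].
Qed.

Lemma code_vertex p : code p %/ 3 = p.1.
Proof. by rewrite /code mulnC divnMDl // divn_small ?addn0. Qed.

Lemma code_colour p : code p - (p.1 + (p.1 + p.1)) = p.2.
Proof. rewrite /code; lia. Qed.

Lemma code_lt p : code p < L.
Proof.
have := ltn_ord p.1; have := ltn_ord p.2; rewrite size_encode /code; lia.
Qed.

Lemma vertex_lt (u : 'I_n) : u < L.
Proof. have := ltn_ord u; rewrite size_encode; lia. Qed.

Lemma nvert_lt : n < L.
Proof. rewrite size_encode; lia. Qed.

Lemma code_inj : injective code.
Proof.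
move=> [u a] [v b] h; have := code_colour (u, a); have := code_colour (v, b).
have := code_vertex (u, a); have := code_vertex (v, b); rewrite h /= => -> /val_inj ->.
by move=> -> /val_inj ->.
Qed.

Section Terms.
Variables (s : memory) (e : nat -> nat).

Lemma truth_stopped e' : truth w s e' t_stopped = (n <= e' 10).
Proof.
apply/truth_sum/idP => [[j jL]|ni]; last first.
  exists n; first exact: nvert_lt.
  rewrite truth_and !truth_not truth_lt truth_input /= /upd /= -leqNgt ni.
  by rewrite nth_encode_stop.
rewrite truth_and !truth_not truth_lt truth_input /= /upd /= -leqNgt.
case: (leqP n (e' 10)) => // ni /andP[ji].
by rewrite nth_encode_unary // (leq_ltn_trans ji).
Qed.

Lemma teval_nvert e' : teval w s e' t_nvert = n.
Proof.
rewrite -[RHS](minn_idPr (ltnW nvert_lt)) -sum_ltn.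
rewrite -[LHS]/(\sum_(0 <= i < L) (1 - teval w s (upd e' 10 i) t_stopped)).
apply: eq_big_nat => i _.
have := truth_stopped (upd e' 10 i); rewrite /truth ltnNge {2}/upd eqxx => <-.
by case: teval => [|k]; rewrite ?subSS ?sub0n.
Qed.

Lemma teval_row t k : (forall i, teval w s (upd e 13 i) t = k) -> k <= L ->
  teval w s e (t_row t) = k * n.
Proof.
move=> tk kL; rewrite -[X in X * n](minn_idPr kL) -sum_ltn big_distrl.
rewrite -[LHS]/(\sum_(0 <= i < L) if teval w s (upd e 13 i) t - i != 0
  then teval w s (upd e 13 i) t_nvert else 0).
apply: eq_bigr => i _; rewrite tk teval_nvert subn_eq0 -ltnNge.
by case: ltnP => _ /=; rewrite ?mul1n ?mul0n.
Qed.

Variables (i : nat) (p : lit).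
Hypotheses (i_lt : i < 10) (ei : e i = code p).

Lemma upd_ge y k : 10 <= y -> upd e y k i = e i.
Proof. by move=> y10; rewrite /upd ltn_eqF // (leq_trans i_lt). Qed.

Lemma teval_vertex_lit : teval w s e (t_vertex i) = p.1.
Proof.
rewrite teval_vertex ?ei ?code_vertex //; first by rewrite ltn_eqF // (ltn_trans i_lt).
exact/ltnW/vertex_lt.
Qed.

Lemma teval_colour_lit : teval w s e (t_colour i) = p.2.
Proof. by rewrite -code_colour -teval_vertex_lit -ei. Qed.

Lemma truth_allowed : truth w s e (t_allowed i) = allowed p.
Proof.
have rowE : teval w s e (t_row t_nvert) = n * n.
  by apply: teval_row (ltnW nvert_lt) => j; apply: teval_nvert.
rewrite truth_input -nth_encode_list; congr nth.
rewrite -[LHS]/(teval w s e t_nvert + 1 + teval w s e (t_row t_nvert) + e i).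
by rewrite rowE teval_nvert ei.
Qed.

End Terms.

Lemma truth_adj s e i j p q : i < 10 -> j < 10 -> e i = code p -> e j = code q ->
  truth w s e (t_adj i j) = graph x p.1 q.1.
Proof.
move=> i10 j10 ei ej.
have rowE : teval w s e (t_row (t_vertex i)) = p.1 * n.
  apply: teval_row (ltnW (vertex_lt _)) => k.
  by apply: teval_vertex_lit; rewrite ?upd_ge.
rewrite truth_input -nth_encode_adj; congr nth.
rewrite -[LHS]/(teval w s e t_nvert + 1 + teval w s e (t_row (t_vertex i)) +
  teval w s e (t_vertex j)).
by rewrite rowE teval_nvert (teval_vertex_lit s j10 ej).
Qed.

(** Guesses run through all numbers below [L]. One that encodes no literal excludes nothing, which
    is harmless: [accepting_sound] holds for every exclusion predicate. *)
Definition excluded (gs : seq nat) (p : lit) :=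
  has (fun g => (p.1 == g %/ 3 :> nat) && (code p != g)) gs.

(** Only entries indexed by codes of literals carry meaning; the rest of the table may hold
    anything. *)
Definition stored (s : memory) : {set lit * lit} :=
  [set pq | s Table (code pq.1 + L * code pq.2) != 0].

Lemma stored_refuted s e p q t1 t2 : teval w s e t1 = code p ->
  (forall i, teval w s (upd e 14 i) t2 = code q) ->
  truth w s e (t_refuted t1 t2) = ((p, q) \in stored s).
Proof. by move=> h1 h2; rewrite (truth_refuted h1 h2) inE. Qed.

(** * Running the program on one guess *)

Section Guess.
Variables (g1 g2 g3 : nat).
Hypotheses (g1L : g1 < L) (g2L : g2 < L) (g3L : g3 < L).

Definition guess_env (e : nat -> nat) := [/\ e 5 = g1, e 6 = g2 & e 7 = g3].

Let step := refute_step (graph x) allowed (excluded [:: g1; g2; g3]).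

Lemma truth_excluded1 s e p k g : e 0 = code p -> k < 10 -> e k = g -> g < L ->
  truth w s e (t_excluded1 0 k) = (p.1 == g %/ 3 :> nat) && (code p != g).
Proof.
move=> e0 k10 ek gL; rewrite truth_and truth_not !truth_eq.
rewrite (teval_vertex_lit s _ e0) // teval_vertex ?ek.
- by rewrite /= e0 ek.
- by rewrite ltn_eqF // (ltn_trans k10).
- exact: leq_trans (leq_div _ _) (ltnW gL).
Qed.

Lemma truth_clash s e p q : guess_env e -> e 0 = code p -> e 1 = code q ->
  truth w s e t_clash =
    clash (graph x) allowed (excluded [:: g1; g2; g3]) p q.
Proof.
move=> [e5 e6 e7] e0 e1; rewrite /clash /excluded /= orbF.
rewrite !truth_or truth_not (truth_allowed s e0).
rewrite (truth_excluded1 s e0 _ e5) // (truth_excluded1 s e0 _ e6) //.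
rewrite (truth_excluded1 s e0 _ e7) //.
rewrite !truth_and truth_not !truth_eq (truth_adj s _ _ e0 e1) //.
rewrite (teval_vertex_lit s _ e0) // (teval_vertex_lit s _ e1) //.
by rewrite (teval_colour_lit s _ e0) // (teval_colour_lit s _ e1).
Qed.

Lemma teval_lit s (e : nat -> nat) v (a : 'I_3) (u : 'I_n) :
  e v = u -> teval w s e (t_lit v a) = code (u, a).
Proof. by rewrite /= /code => -> /=; lia. Qed.

Lemma truth_blocks s (e : nat -> nat) p q (u : 'I_n) (a : 'I_3) :
  e 0 = code p -> e 1 = code q -> e 2 = u ->
  truth w s e (t_blocks a) =
    ((p, (u, a)) \in stored s) || ((q, (u, a)) \in stored s).
Proof.
move=> e0 e1 e2; have lit3 j : teval w s (upd e 14 j) (t_lit 2 a) = code (u, a).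
  exact: teval_lit.
rewrite truth_or (stored_refuted (t1 := TVar 0) e0 lit3).
by rewrite (stored_refuted (t1 := TVar 1) e1 lit3).
Qed.

Lemma truth_step s e p q : guess_env e -> e 0 = code p -> e 1 = code q ->
  truth w s e t_step = ((p, q) \in step (stored s)).
Proof.
move=> ge e0 e1; rewrite inE (truth_or _ _ _ t_clash).
rewrite (truth_or _ _ _ (t_refuted _ _)); congr [|| _, _ | _].
- exact: truth_clash.
- by apply: stored_refuted => //= i; rewrite /upd.
apply/truth_sum/existsP => [[v vL]|[v /forallP h]].
  rewrite truth_and truth_lt teval_nvert => /andP[/= vn].
  rewrite !truth_and => /and3P[h0 h1 h2]; exists (Ordinal vn).
  apply/forallP=> a; rewrite -(@truth_blocks s (upd e 2 v)) //.
  by case: a => [[|[|[|//]]] ?].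
have hb (a : 'I_3) : truth w s (upd e 2 v) (t_blocks a).
  by rewrite (@truth_blocks s (upd e 2 v) p q v a) ?h.
exists v; first exact: vertex_lt.
rewrite truth_and truth_lt teval_nvert [X in X && _]ltn_ord /=.
rewrite !truth_and; apply/and3P; split.
- exact: hb (@Ordinal 3 0 isT).
- exact: hb (@Ordinal 3 1 isT).
- exact: hb (@Ordinal 3 2 isT).
Qed.

Lemma truth_accept s e X : stored s = X ->
  truth w s e t_accept = [forall v, [exists a : 'I_3, ((v, a), (v, a)) \in X]
    && [exists a : 'I_3, ((v, a), (v, a)) \notin X]].
Proof.
move=> <-; have dead (v : 'I_n) (a : 'I_3) :
    truth w s (upd e 2 v) (t_dead a) = (((v, a), (v, a)) \in stored s).
  by apply: stored_refuted => [|j]; apply: teval_lit.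
have d0 v := dead v (@Ordinal 3 0 isT); have d1 v := dead v (@Ordinal 3 1 isT).
have d2 v := dead v (@Ordinal 3 2 isT); rewrite /= in d0 d1 d2.
have ord3 (P : pred 'I_3) : [exists a, P a] =
    [|| P (@Ordinal 3 0 isT), P (@Ordinal 3 1 isT) | P (@Ordinal 3 2 isT)].
  apply/existsP/or3P => [[[[|[|[|//]]] a3]]|[]]; last 3 first.
  - by exists (@Ordinal 3 0 isT).
  - by exists (@Ordinal 3 1 isT).
  - by exists (@Ordinal 3 2 isT).
  - by rewrite (bool_irrelevance a3 isT); constructor.
  - by rewrite (bool_irrelevance a3 isT); constructor.
  - by rewrite (bool_irrelevance a3 isT); constructor.
have vE (v : 'I_n) : truth w s (upd e 2 v)
    (TIf (TAdd (t_dead 0) (TAdd (t_dead 1) (t_dead 2)))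
      (tnot (TIf (t_dead 0) (TIf (t_dead 1) (t_dead 2))))) =
    [exists a : 'I_3, ((v, a), (v, a)) \in stored s] &&
    [exists a : 'I_3, ((v, a), (v, a)) \notin stored s].
  rewrite truth_and truth_not !ord3 -!d0 -!d1 -!d2.
  rewrite (truth_or _ _ _ (t_dead 0)) (truth_or _ _ _ (t_dead 1)).
  rewrite (truth_and _ _ _ (t_dead 0)) (truth_and _ _ _ (t_dead 1)).
  by rewrite !negb_and.
rewrite truth_not; apply/idP/forallP => [/negP no v|h].
  rewrite -vE; apply: contraT => nv; case: no; apply/truth_sum.
  exists v; first exact: vertex_lt.
  by rewrite truth_and truth_lt teval_nvert [X in X && _]ltn_ord truth_not.
apply/negP=> /truth_sum[v vL].
rewrite truth_and truth_lt teval_nvert => /andP[/= vn].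
by rewrite truth_not (vE (Ordinal vn)) h.
Qed.

Lemma stored_update t e s : ~~ reads Buffer t ->
  stored (run w e (p_update t) s) = [set pq |
    truth w s (upd (upd e 0 (code pq.1)) 1 (code pq.2)) t].
Proof.
move=> /(run_update w e s)[h _]; apply/setP=> pq.
by rewrite !in_set h ?code_lt.
Qed.

Lemma run_rounds e s : guess_env e -> stored s = set0 ->
  let s' := run w e (PFor 3 (PFor 4 (p_update t_step))) s in
  stored s' = refuted (graph x) allowed (excluded [:: g1; g2; g3]) /\
  s' Answer =1 s Answer.
Proof.
move=> [e5 e6 e7] s0.
pose J i s' := stored s' = iter i step set0 /\ s' Answer =1 s Answer.
suff [sE ansE] : J (L * L) (run w e (PFor 3 (PFor 4 (p_update t_step))) s).
  split=> //; rewrite sE refuted_iter // !card_prod !card_ord.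
  by apply: leq_mul; rewrite size_encode leq_addl.
rewrite run_for; apply: (iteri_inv (I := fun i => J (i * L))) => // i s1 iL Ji.
rewrite mulSnr run_for; apply: (iteri_inv (I := fun j => J (i * L + j))).
  by rewrite addn0.
move=> j s2 jL [s2E ans2]; rewrite addnS; split; last first.
  have [|_ ans3] := @run_update w t_step (upd (upd e 3 i) 4 j) s2; first by [].
  by move=> k; rewrite ans3 ans2.
rewrite stored_update // iterS -s2E; apply/setP=> -[p q]; rewrite in_set.
by apply: truth_step => //; split; rewrite ?e5 ?e6 ?e7.
Qed.

Lemma run_guess e s : guess_env e ->
  (run w e p_guess s Answer 0 != 0) = (s Answer 0 != 0) ||
    accepting (graph x) allowed (excluded [:: g1; g2; g3]).
Proof.
move=> ge; set s1 := run w e (p_update (TLit 0)) s.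
have [|_] := @run_update w (TLit 0) e s; first by [].
rewrite -/s1 => ans1.
have s10 : stored s1 = set0.
  by rewrite stored_update //; apply/setP=> pq; rewrite !inE.
have [s2E ans2] := run_rounds ge s10.
set s2 := run w e _ s1 in s2E ans2.
rewrite -[run _ _ _ _]/(set_bank s2 Answer 0 (s2 Answer 0 + teval w s2 e t_accept)).
rewrite /set_bank /= /upd /= addn_eq0 negb_and ans2 ans1; congr (_ || _).
exact: truth_accept.
Qed.

End Guess.
(** The hypothesis covers every memory [s] because a round inherits the tables left by earlier ones;
    only the answer cell transmits information. *)
Lemma run_any e y c (A : nat -> bool) :
  (forall i s, i < L ->
     (run w (upd e y i) c s Answer 0 != 0) = (s Answer 0 != 0) || A i) ->
  forall s, (run w e (PFor y c) s Answer 0 != 0) =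
    (s Answer 0 != 0) || has A (iota 0 L).
Proof.
move=> h s; rewrite run_for.
apply: (iteri_inv (I := fun k s' =>
  (s' Answer 0 != 0) = (s Answer 0 != 0) || has A (iota 0 k))).
  by rewrite orbF.
by move=> i s' iL IH; rewrite h // IH -[i.+1]addn1 iotaD has_cat /= orbF orbA.
Qed.

Lemma run_main : (run w (fun=> 0) p_main (fun _ _ => 0) Answer 0 != 0) =
  has (fun g1 => has (fun g2 => has (fun g3 =>
    accepting (graph x) allowed (excluded [:: g1; g2; g3]))
    (iota 0 L)) (iota 0 L)) (iota 0 L).
Proof.
rewrite (run_any (A := fun g1 => has (fun g2 => has (fun g3 =>
  accepting (graph x) allowed (excluded [:: g1; g2; g3]))
  (iota 0 L)) (iota 0 L))) // => g1 s1 g1L.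
apply: run_any => g2 s2 g2L; apply: run_any => g3 s3 g3L.
exact: run_guess.
Qed.

(** * From forcing triples to accepted guesses *)

Lemma diameter2_dist : has_diameter (graph x) 2 -> forall u v,
  [\/ u = v, graph x u v | exists2 t, graph x u t & graph x t v].
Proof.
move=> [d2 _] u v; have [k [[p [pp _ vE pk]] _] k2] := d2 u v.
case: p pp vE pk => [|a [|b p]] /=; first by move=> _ ->; constructor 1.
  by rewrite andbT => ua <- _; constructor 2.
case: p => [|? ?]; last by move=> _ _ kE; rewrite -kE in k2.
by move=> /and3P[ua ab _] <- _; constructor 3; exists a.
Qed.

Lemma diameter2_edge : has_diameter (graph x) 2 -> exists u v, graph x u v.
Proof.
by move=> [_ [u [v [[[|a p] [//= /andP[ua _] _ _ _]] _]]]]; exists u, a.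
Qed.

Lemma forcing_triple s (c : 'I_n -> 'I_3) : s \in [:: 5; 6] ->
  free_of (cycle_graph s) (graph x) -> has_diameter (graph x) 2 ->
  (forall u v, graph x u v -> c u != c v) ->
  exists u v t, forcing (graph x) c u v t.
Proof.
rewrite !inE => /orP[] /eqP-> free diam cP.
  exact: forcing_c5 cP (diameter2_dist diam) free (diameter2_edge diam).
exact: forcing_c6 cP (diameter2_dist diam) free (diameter2_edge diam).
Qed.

(** Guesses taken from [c] exclude no literal of [c] and settle the guessed vertices at once, so
    [forcing] applies to the closed set of settled vertices. *)
Lemma accepting_guess (c : 'I_n -> 'I_3) u v t :
  (forall u v, graph x u v -> c u != c v) -> (forall v, allowed (v, c v)) ->
  forcing (graph x) c u v t ->
  accepting (graph x) allowed
    (excluded [:: code (u, c u); code (v, c v); code (t, c t)]).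
Proof.
move=> cP cA force; set gs := [:: _; _; _].
have guessed z : code (z, c z) \in gs ->
    settled (graph x) allowed (excluded gs) c z.
  move=> zg; apply: settled_excluded => a az; apply/hasP; exists (code (z, c z)) => //.
  rewrite code_vertex eqxx /=; apply: contraNneq az => /code_inj[->].
  by [].
have kept z : ~~ excluded gs (z, c z).
  apply/hasPn=> g; rewrite !inE negb_and negbK => gE.
  have [z' ->] : exists z', g = code (z', c z').
    by case/or3P: gE => /eqP->; [exists u|exists v|exists t].
  rewrite code_vertex /=; have [->|zz] := eqVneq z z'; first by rewrite !eqxx.
  by rewrite val_eqE zz.
apply: (accepting_complete cP cA kept) => z; apply: force.
- exact: settled_closed.
- by apply: guessed; rewrite !inE eqxx.
- by apply: guessed; rewrite !inE eqxx orbT.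
- by apply: guessed; rewrite !inE eqxx !orbT.
Qed.

Lemma list_colouringP : list_3_colourable x <-> exists c : 'I_n -> 'I_3,
  (forall u v, graph x u v -> c u != c v) /\ forall v, allowed (v, c v).
Proof.
split=> [[c [[_ cP] cL]]|[c [cP cA]]]; last first.
  by exists (fun v => (c v).+1); split=> //; split.
(* Colours 1, 2, 3 are shifted to 0, 1, 2; [lists_sub] guarantees that [inord] does not fall back to
   its default. *)
pose f v : 'I_3 := inord (c v).-1.
have fE v : (f v).+1 = c v.
  have := lists_sub (cL v); rewrite /f !inE => /or3P[] /eqP->; by rewrite inordK.
exists f; split=> [u v uv|v]; last by rewrite /allowed /= fE cL.
by have := cP u v uv; rewrite -!fE; apply: contraNneq => ->.
Qed.

End Decision.

Theorem theorem1 (s : nat) (hs : s \in [:: 5; 6]) :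
  poly_time_solvable encode
    (fun x : instance =>
       free_of (cycle_graph s) (graph x) /\ has_diameter (graph x) 2)
    list_3_colourable.
Proof.
apply: (poly_time_prog (c := p_main)) => x [free diam].
rewrite run_main list_colouringP; split=> [|[c [cP cA]]].
  by move=> /hasP[g1 _ /hasP[g2 _ /hasP[g3 _ /accepting_sound]]].
have [u [v [t force]]] := forcing_triple hs free diam cP.
apply/hasP; exists (code (u, c u)); first by rewrite mem_iota code_lt.
apply/hasP; exists (code (v, c v)); first by rewrite mem_iota code_lt.
apply/hasP; exists (code (t, c t)); first by rewrite mem_iota code_lt.
exact: accepting_guess.
Qed.
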